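(* Let $X$ and $Y$ be Banach spaces with $Y$ separable, and let $\Gamma$ be a set with $|\Gamma|=\aleph_1$. Then $c_0(\Gamma)$ is isomorphic to a subspace of $\mathcal B(Y,X)$ if and only if $c_0(\Gamma)$ is isomorphic to a subspace of $X$.
   Context: $\mathcal B(Y,X)$ is the Banach space of bounded linear operators from $Y$ to $X$ with the operator norm. $c_0(\Gamma)$ is the Banach space of real-valued functions $f$ on $\Gamma$ such that $\{\gamma\in\Gamma:|f(\gamma)|\ge\epsilon\}$ is finite for every $\epsilon>0$, with the supremum norm. ''Isomorphic'' means linearly homeomorphic.
   Formalization: The formal theorem assumes in addition that Y is not the zero space; for Y = {0} and X = c_0(Γ) the claim fails, since B(Y,X) = {0} contains no copy of c_0(Γ) while X does. *)

(* Defs.v *)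
From HB Require Import structures.
From mathcomp Require Import all_boot all_order all_algebra.
From mathcomp Require Import all_classical all_reals.
From mathcomp Require Import topology normedtype.

Set Implicit Arguments.
Unset Strict Implicit.
Unset Printing Implicit Defensive.

Import Order.TTheory GRing.Theory Num.Theory.
Import numFieldNormedType.Exports.

Local Open Scope classical_set_scope.
Local Open Scope ring_scope.

Section sup_norm.
Context {R : realType} {V : normedModType R} {T : Type}.
Implicit Types (A : set T) (f g : T -> V).

(* Since [sup set0 = 0], this is 0 when [A] is empty. *)
Definition sup_norm A f : R := sup [set `|f t| | t in A].

Definition bounded_over A f := exists M : R, forall t, A t -> `|f t| <= M.

Lemma sup_norm_ub A f t : bounded_over A f -> A t -> `|f t| <= sup_norm A f.
Proof.
move=> [M fM] At; apply: ub_le_sup; last by exists t.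
by exists M => _ [s As <-]; exact: fM.
Qed.

Lemma sup_norm_le A f (M : R) : 0 <= M -> (forall t, A t -> `|f t| <= M) ->
  sup_norm A f <= M.
Proof.
move=> M0 fM; have [A0|/set0P[t At]] := eqVneq A set0.
  by rewrite /sup_norm A0 image_set0 sup0.
apply: ge_sup; first by exists `|f t|, t.
by move=> _ [s As <-]; exact: fM.
Qed.

Lemma sup_norm_ge0 A f : bounded_over A f -> 0 <= sup_norm A f.
Proof.
move=> fb; have [A0|/set0P[t At]] := eqVneq A set0.
  by rewrite /sup_norm A0 image_set0 sup0.
exact: le_trans (sup_norm_ub fb At).
Qed.

Lemma sup_normD A f g : bounded_over A f -> bounded_over A g ->
  sup_norm A (f \+ g) <= sup_norm A f + sup_norm A g.
Proof.
move=> fb gb; apply: sup_norm_le => [|t At /=].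
  by rewrite addr_ge0// sup_norm_ge0.
by rewrite (le_trans (ler_normD _ _))// lerD// sup_norm_ub.
Qed.

Lemma sup_normZ A (l : R) f : bounded_over A f ->
  sup_norm A (fun t => l *: f t) = `|l| * sup_norm A f.
Proof.
move=> fb; have [->|l0] := eqVneq l 0.
  have zero t : `|0 *: f t| <= 0 by rewrite scale0r normr0.
  rewrite normr0 mul0r; apply/eqP; rewrite eq_le sup_norm_le//=.
  by rewrite sup_norm_ge0//; exists 0.
have lf : bounded_over A (fun t => l *: f t).
  by case: fb => M fM; exists (`|l| * M) => t At; rewrite normrZ ler_wpM2l ?fM.
apply/eqP; rewrite eq_le; apply/andP; split.
  apply: sup_norm_le => [|t At]; first by rewrite mulr_ge0 ?sup_norm_ge0.
  by rewrite normrZ ler_wpM2l// sup_norm_ub.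
rewrite -ler_pdivlMl ?normr_gt0//; apply: sup_norm_le => [|t At].
  by rewrite mulr_ge0 ?sup_norm_ge0// invr_ge0.
by rewrite ler_pdivlMl ?normr_gt0// -normrZ; exact: (sup_norm_ub lf At).
Qed.

End sup_norm.

Section bounded_operators.
Context {R : realType} (Y X : normedModType R).

Definition bounded_operator : {pred Y -> X} :=
  mem [set f : Y -> X | linear f /\ exists M : R, forall y, `|f y| <= M * `|y|].

Record bop := Bop { bop_fun :> Y -> X ; _ : bop_fun \in bounded_operator }.

HB.instance Definition _ := [isSub for bop_fun].
HB.instance Definition _ := [Choice of bop by <:].

Lemma bounded_operator_submod_closed : submod_closed bounded_operator.
Proof.
split=> [|a f g]; rewrite !inE.
  split=> [b u v|]; first by rewrite scaler0 addr0.
  by exists 0 => y; rewrite normr0 mul0r.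
move=> [fl [M fM]] [gl [N gN]]; split=> [b u v|].
  rewrite !fctE fl gl !scalerDr !scalerA -!addrA; congr (_ + _).
    by rewrite mulrC.
  by rewrite addrCA.
exists (`|a| * M + N) => y; rewrite !fctE mulrDl -mulrA.
by rewrite (le_trans (ler_normD _ _))// lerD// normrZ ler_wpM2l.
Qed.

HB.instance Definition _ := GRing.isSubmodClosed.Build _ _ bounded_operator
  bounded_operator_submod_closed.
HB.instance Definition _ := [SubChoice_isSubLmodule of bop by <:].

Definition op_norm (f : bop) : R := sup_norm [set y : Y | `|y| <= 1] f.

Lemma bop_linear (f : bop) : linear f.
Proof. by have := valP f; rewrite inE => -[]. Qed.

HB.instance Definition _ (f : bop) :=
  GRing.isLinear.Build R Y X *:%R f (bop_linear f).

Lemma bop_bounded (f : bop) : bounded_over [set y : Y | `|y| <= 1] f.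
Proof.
have := valP f; rewrite inE => -[_ [M fM]]; exists `|M| => y /= y1.
apply: (le_trans (fM y)); apply: (@le_trans _ _ (`|M| * `|y|)).
  by rewrite ler_wpM2r// ler_norm.
by rewrite ler_piMr.
Qed.

Lemma op_normP (f : bop) y : `|f y| <= op_norm f * `|y|.
Proof.
have [->|y0] := eqVneq y 0; first by rewrite linear0 !normr0 mulr0.
rewrite -ler_pdivrMr ?normr_gt0// mulrC -[X in X * _]ger0_norm ?invr_ge0//.
rewrite -normrZ -linearZ; apply: (sup_norm_ub (bop_bounded f)) => /=.
by rewrite normrZ ger0_norm ?invr_ge0// mulVf// normr_eq0.
Qed.

Lemma op_normD f g : op_norm (f + g) <= op_norm f + op_norm g.
Proof. exact: sup_normD (bop_bounded f) (bop_bounded g). Qed.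

Lemma op_normZ (l : R) f : op_norm (l *: f) = `|l| * op_norm f.
Proof. exact: sup_normZ (bop_bounded f). Qed.

Lemma op_norm_eq0 f : op_norm f = 0 -> f = 0.
Proof.
move=> f0; apply/val_inj/funext => y /=; apply/eqP; rewrite -normr_le0.
by have := op_normP f y; rewrite f0 mul0r.
Qed.

HB.instance Definition _ :=
  Lmodule_isNormed.Build R bop op_normD op_normZ op_norm_eq0.

End bounded_operators.

Section c0.
Context (R : realType) (G : Type).

Definition vanishing : {pred G -> R} :=
  mem [set f : G -> R | forall e : R, 0 < e -> finite_set [set g | e <= `|f g|]].

Record c0 := C0 { c0_fun :> G -> R ; _ : c0_fun \in vanishing }.

HB.instance Definition _ := [isSub for c0_fun].
HB.instance Definition _ := [Choice of c0 by <:].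

Lemma vanishing_submod_closed : submod_closed vanishing.
Proof.
split=> [|a f h]; rewrite !inE => /=.
  move=> e e0; rewrite (_ : mkset _ = set0)//; apply/seteqP; split=> // g /=.
  by rewrite normr0 leNgt e0.
move=> fv hv e e0; have a0 : 0 < `|a| + 1 by rewrite ltr_wpDl.
have e2 : 0 < e / 2 by rewrite divr_gt0.
apply: (@sub_finite_set _ _ ([set g | e / 2 / (`|a| + 1) <= `|f g|] `|`
                             [set g | e / 2 <= `|h g|])); last first.
  by rewrite finite_setU; split; [apply: fv; rewrite divr_gt0|exact: hv].
move=> g /=; rewrite !fctE => eg.
have [|hg] := leP (e / 2) `|h g|; [by right|left].
rewrite ler_pdivrMr// leNgt; apply/negP => fg.
suff : `|a *: f g + h g| < e by rewrite ltNge eg.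
rewrite (le_lt_trans (ler_normD _ _))// [ltRHS]splitr ltrD// normrZ.
by rewrite (le_lt_trans _ fg)// mulrC ler_wpM2l// lerDl.
Qed.

HB.instance Definition _ := GRing.isSubmodClosed.Build _ _ vanishing
  vanishing_submod_closed.
HB.instance Definition _ := [SubChoice_isSubLmodule of c0 by <:].

Definition c0_norm (f : c0) : R := sup_norm [set: G] f.

Lemma c0_bounded (f : c0) : bounded_over [set: G] f.
Proof.
have := valP f; rewrite inE => /(_ 1 ltr01) /= f1.
have /finite_seqP[S SE] := finite_image (fun g => `|f g|) f1.
exists (1 + \sum_(x <- S) `|x|) => g _.
have [fg|/ltW fg] := leP 1 `|f g|; last first.
  by rewrite (le_trans fg)// lerDl sumr_ge0.
have gS : `|f g| \in S.
  by have : [set` S] `|f g| by rewrite -SE; exists g.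
rewrite ler_wpDl// (big_rem _ gS)/= normr_id lerDl.
by rewrite sumr_ge0.
Qed.

Lemma c0_normD f h : c0_norm (f + h) <= c0_norm f + c0_norm h.
Proof. exact: sup_normD (c0_bounded f) (c0_bounded h). Qed.

Lemma c0_normZ (l : R) f : c0_norm (l *: f) = `|l| * c0_norm f.
Proof. exact: sup_normZ (c0_bounded f). Qed.

Lemma c0_norm_eq0 f : c0_norm f = 0 -> f = 0.
Proof.
move=> f0; apply/val_inj/funext => g /=; apply/eqP; rewrite -normr_le0.
by rewrite -f0; exact: (sup_norm_ub (c0_bounded f)).
Qed.

HB.instance Definition _ :=
  Lmodule_isNormed.Build R c0 c0_normD c0_normZ c0_norm_eq0.

End c0.

Definition separable (T : topologicalType) :=
  exists2 D : set T, countable D & dense D.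

(* [T] is linear and restricts to a homeomorphism from [E] onto the linear
   subspace [Z], whose inverse is the restriction of [S] to [Z].  The subspace
   is not asked to be closed: when [E] is complete this is automatic. *)
Definition isomorphic_to_subspace (R : realType) (E F : normedModType R) :=
  exists (Z : set F) (T : {linear E -> F}) (S : F -> E),
    submod_closed (mem Z : {pred F}) /\
    [/\ forall x, Z (T x), cancel T S, forall z, Z z -> T (S z) = z,
        continuous T & {within Z, continuous S}].

(* The cardinal of [G] is the least uncountable one. *)
Definition has_card_aleph1 (G : Type) :=
  ~ countable [set: G] /\
  forall (T : Type) (A : set T), ~ countable A -> ([set: G] #<= A)%card.

(* Main.v *)
(* For the direct implication, let T embed c0(G) into B(Y,X).  No T e_g
   vanishes, hence none of them vanishes on the whole countable dense set of Y,
   and a single d in that set satisfies T e_g d <> 0 for uncountably many g.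
   It remains to prove Rosenthal's theorem for the operator S f := T f d:
   restrict to uncountably many g with |S e_g| >= d0 > 0, and choose norm one
   functionals phi_g on X with phi_g (S e_g) = |S e_g|.  As phi_g \o S is a
   bounded functional on c0(G), it is at most d0 / 2 in norm on the functions
   that vanish on some finite set F_g.  An uncountable W with u \notin F_v for
   all distinct u, v in W then gives |S f| >= (d0 / 2) |f| for f supported in W,
   and the minimality of the cardinal of G lets c0(G) embed in c0(W).

   For the converse, x is sent to the operator y |-> phi y *: x, where phi is a
   norming functional of some nonzero vector of Y. *)
Require Import Defs.
From HB Require Import structures.
From mathcomp Require Import all_boot all_order all_algebra.
From mathcomp Require Import all_classical all_reals.
From mathcomp Require Import topology normedtype.
From mathcomp Require Import lra.
Set Implicit Arguments.
Unset Strict Implicit.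
Unset Printing Implicit Defensive.
Import Order.TTheory GRing.Theory Num.Theory numFieldNormedType.Exports.
Local Open Scope ring_scope.
Local Open Scope classical_set_scope.

(** * Free sets for maps with finite values *)

Section uncountable.
Context (T : choiceType).
Implicit Types (V W : set T) (F : T -> seq T).

Lemma uncountable_bigcup I (D : set I) V (W : I -> set T) :
  countable D -> ~ countable V -> V `<=` \bigcup_(i in D) W i ->
  exists2 i, D i & ~ countable (V `&` W i).
Proof.
move=> Dc Vu VW; apply: contrapT => /forall2NP no; apply: Vu.
apply: (@sub_countable _ _ _ (\bigcup_(i in D) (V `&` W i))).
  by apply: subset_card_le => v Vv; have [i Di Wi] := VW _ Vv; exists i.
by apply: bigcup_countable => // i Di; case: (no i) => // /contrapT.
Qed.

Definition free_set F V := forall u v, V u -> V v -> u != v -> u \notin F v.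

(** Freeness constrains two points at a time, so it passes to unions of chains and Zorn's lemma
    applies. *)
Lemma maximal_free_set F V : exists M, [/\ M `<=` V, free_set F M &
  forall v, V v -> free_set F (M `|` [set v]) -> M v].
Proof.
have [|M [[MV Mfree] maxM]] :=
    @Zorn_bigcup T [set W | W `<=` V /\ free_set F W].
  move=> C CP Ctot; split=> [x [W /CP [WV _] /WV]//|].
  move=> u v [U CU Uu] [W CW Ww] uv.
  have [UW|WU] := Ctot _ _ CU CW.
    by case: (CP _ CW) => _; apply=> //; exact: UW.
  by case: (CP _ CU) => _; apply=> //; exact: WU.
exists M; split=> // v Vv free_v; apply: contrapT => Mv.
apply: (maxM (M `|` [set v])); last by split=> // x [/MV//|->].
by split=> [x Mx|/(_ v (or_intror erefl))//]; left.
Qed.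

(** Induction on [n]. If a maximal free set [M] is countable, so is [N], and for [v] in [V] outside
    [N] maximality forces [F v] to meet [M]. Deleting the points of [M] then shortens [F v], and it
    does not affect freeness of sets disjoint from [M]. *)
Lemma uncountable_free_set_size F V n : ~ countable V ->
  (forall v, V v -> (size (F v) <= n)%N) ->
  exists W, [/\ W `<=` V, ~ countable W & free_set F W].
Proof.
elim: n F V => [|n IH] F V Vu Fn.
  by exists V; split=> // u v _ /Fn; rewrite leqn0 => /nilP ->.
have [M [MV Mfree Mmax]] := maximal_free_set F V.
have [Mc|Mu] := pselect (countable M); last by exists M.
pose N := M `|` \bigcup_(m in M) [set` F m].
have Nc : countable N.
  have -> : N = \bigcup_(m in M) ([set m] `|` [set` F m]).
    apply/seteqP; split=> x.
      by case=> [Mx|[m Mm xm]]; [exists x => //; left|exists m => //; right].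
    by case=> m Mm [->|xm]; [left|right; exists m].
  apply: bigcup_countable => // m _; apply: finite_set_countable.
  by rewrite finite_setU.
pose F' v := [seq x <- F v | `[< ~ M x >]].
have [||W [WV Wu Wfree]] := IH F' (V `\` N).
- move=> VNc; apply: Vu; apply: (@sub_countable _ _ _ ((V `\` N) `|` N)).
    by apply: subset_card_le => x Vx; have [|] := pselect (N x); [right|left].
  by rewrite -bigcup2E; apply: bigcup_countable => // -[|[|?]].
- move=> v [Vv Nv]; rewrite -ltnS; apply: leq_trans (Fn _ Vv).
  have [m Mm mv] : exists2 m, M m & m \in F v.
    apply: contrapT => /forall2NP no; apply: (Nv); left; apply: Mmax => //.
    move=> x y [Mx|->] [My|->] xy; first exact: Mfree.
    - by apply/negP => xv; case: (no x).
    - by apply/negP => vy; apply: Nv; right; exists y.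
    - by rewrite eqxx in xy.
  rewrite size_filter -(count_predC (fun x => `[< ~ M x >]) (F v)) -addn1.
  rewrite leq_add2l -has_count; apply/hasP; exists m => //=.
  by apply/negP => /asboolP.
- exists W; split=> // [x /WV[]//|u v Wu' Wv uv].
  have [_ Nu] := WV _ Wu'.
  have := Wfree _ _ Wu' Wv uv; rewrite mem_filter.
  suff -> : `[< ~ M u >] by [].
  by apply/asboolP => Mu; apply: Nu; left.
Qed.

(** One of the countably many sets on which [F] has size at most [n] is uncountable. *)
Lemma uncountable_free_set F V : ~ countable V ->
  exists W, [/\ W `<=` V, ~ countable W & free_set F W].
Proof.
move=> Vu; have [|n _ Vn] := @uncountable_bigcup nat setT V
    (fun n => [set v | (size (F v) <= n)%N]) (countableP _) Vu.
- by move=> v _; exists (size (F v)) => /=.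
- have [|W [WV Wu Wfree]] := uncountable_free_set_size (n := n) Vn (F := F).
    by move=> v [].
  by exists W; split=> // x /WV[].
Qed.

End uncountable.

(** * Hahn-Banach theorem for functionals of norm at most 1 *)

Section hahn_banach.
Context (R : realType) (V : normedModType R).
Implicit Types A : set (V * R).

(* Graphs of linear functionals of norm at most 1 on a subspace of [V]: single
   valuedness is a consequence of the norm bound. *)
Definition dominated_graph A :=
  (forall (a : R) x y, A x -> A y -> A (a *: x.1 + y.1, a * x.2 + y.2)) /\
  forall x, A x -> x.2 <= `|x.1|.

Lemma dominated_graph0 A : dominated_graph A -> A !=set0 -> A (0, 0).
Proof.
move=> [Al _] [x Ax]; have := Al (-1) x x Ax Ax.
by rewrite scaleN1r mulN1r !addNr.
Qed.

Lemma dominated_graphZ A (a : R) y r : dominated_graph A -> A (y, r) ->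
  A (a *: y, a * r).
Proof.
move=> AG Ay.
have A0 : A (0, 0) by apply: dominated_graph0 => //; exists (y, r).
by have := AG.1 a _ _ Ay A0; rewrite /= !addr0.
Qed.

Lemma dominated_graph_fun A y r s : dominated_graph A -> A (y, r) -> A (y, s) ->
  r = s.
Proof.
move=> [Al Ab] Ar As; have := Ab _ (Al (-1) _ _ Ar As).
have := Ab _ (Al (-1) _ _ As Ar).
by rewrite /= scaleN1r addNr normr0; lra.
Qed.

(** A value [c] at [x] is admissible when [u.2 - |u.1 - x| <= c <= |u.1 + x| - u.2] for all [u] in
    [A]. By the triangle inequality every lower bound is below every upper bound, so the supremum of
    the lower ones will do. *)
Lemma dominated_graph_extension A (x : V) : dominated_graph A -> A !=set0 ->
  exists B c, [/\ dominated_graph B, A `<=` B & B (x, c)].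
Proof.
move=> AG A_neq0; have A0 := dominated_graph0 AG A_neq0.
have [Al Ab] := AG.
pose E := [set u.2 - `|u.1 - x| | u in A].
have EU u : A u -> ubound E (`|u.1 + x| - u.2).
  move=> Au _ [w Aw <-]; have := Ab _ (Al 1 _ _ Aw Au).
  rewrite /= scale1r mul1r.
  have := ler_normD (w.1 - x) (u.1 + x); rewrite addrACA addNr addr0; lra.
have E0 : E !=set0 by exists (0 - `|0 - x|), (0, 0).
have Elow u : A u -> u.2 - sup E <= `|u.1 - x|.
  move=> Au; rewrite lerBlDr -lerBlDl; apply: ub_le_sup; last by exists u.
  by exists (`|0 + x| - 0); exact: (EU (0, 0)).
have Eup u : A u -> u.2 + sup E <= `|u.1 + x|.
  by move=> /EU Au; rewrite -lerBrDl; exact: ge_sup.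
pose B := [set (u.1 + t *: x, u.2 + t * sup E) | u in A & t in [set: R]].
exists B, (sup E); split.
- split.
    move=> a _ _ [u Au [t _ <-]] [w Aw [s _ <-]].
    exists (a *: u.1 + w.1, a * u.2 + w.2); first exact: Al.
    exists (a * t + s) => //=; congr pair; last by lra.
    by rewrite scalerDr scalerDl -scalerA addrACA.
  move=> _ [[y r] Ay [t _ <-]] /=.
  (* For nonzero [t], dividing by [|t|] reduces the bound to [Eup] or [Elow]. *)
  have [t0|t0|<-] := ltgtP 0 t.
  - rewrite (_ : r + _ = t * (t^-1 * r + sup E)); last first.
      by rewrite mulrDr mulVKf ?gt_eqF.
    rewrite (_ : y + _ = t *: (t^-1 *: y + x)); last first.
      by rewrite scalerDr scalerA divff ?gt_eqF// scale1r.
    rewrite normrZ gtr0_norm// ler_pM2l//.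
    exact: Eup (dominated_graphZ t^-1 AG Ay).
  - have Nt0 : 0 < - t by rewrite oppr_gt0.
    rewrite (_ : r + _ = - t * ((- t)^-1 * r - sup E)); last first.
      by rewrite mulrBr mulVKf ?gt_eqF// mulNr opprK.
    rewrite (_ : y + _ = - t *: ((- t)^-1 *: y - x)); last first.
      by rewrite scalerBr scalerA divff ?gt_eqF// scale1r scaleNr opprK.
    rewrite normrZ gtr0_norm// ler_pM2l//.
    exact: Elow (dominated_graphZ (- t)^-1 AG Ay).
  - by rewrite scale0r mul0r !addr0; exact: (Ab (y, r)).
- move=> [y r] Ay; exists (y, r) => //; exists 0 => //=.
  by rewrite scale0r mul0r !addr0.
- by exists (0, 0) => //; exists 1 => //=; rewrite scale1r mul1r !add0r.
Qed.

Lemma maximal_dominated_graph A : dominated_graph A -> A !=set0 ->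
  exists B, [/\ dominated_graph B, A `<=` B & forall x, exists r, B (x, r)].
Proof.
move=> AG [w Aw].
(* The empty graph is allowed, as the union of the empty chain. *)
have [|B [[BG BA] maxB]] := @Zorn_bigcup _
    [set B : set (V * R) | dominated_graph B /\ (B !=set0 -> A `<=` B)].
  move=> C CP Ctot; split; last first.
    move=> [u [W CW Wu]] x Ax; exists W => //.
    by have [_] := CP _ CW; apply=> //; exists u.
  split=> [a x y [W CW Wx] [Z CZ Zy]|x [W CW Wx]]; last first.
    by have [[_ Wb] _] := CP _ CW; exact: Wb.
  have [WZ|ZW] := Ctot _ _ CW CZ.
    by have [[Zl _] _] := CP _ CZ; exists Z => //; apply: Zl => //; exact: WZ.
  by have [[Wl _] _] := CP _ CW; exists W => //; apply: Wl => //; exact: ZW.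
have B_neq0 : B !=set0.
  apply/set0P/eqP => B0; apply: (maxB A); last by split=> // _ ?.
  by rewrite B0; split=> [x []|/(_ w Aw)].
exists B; split=> // [|x]; first exact: BA.
have [Z [c [ZG BZ Zc]]] := dominated_graph_extension x BG B_neq0.
exists c; apply: contrapT => Bc; apply: (maxB Z).
  by split=> // /(_ _ Zc).
by split=> // _; apply: subset_trans BZ; exact: BA.
Qed.

(** The functional [t *: v |-> t * |v|] on the line through [v] is extended to the whole space. *)
Lemma norming_functional (v : V) :
  exists f : {scalar V}, f v = `|v| /\ forall x, `|f x| <= `|x|.
Proof.
pose L := [set (t *: v, t * `|v|) | t in [set: R]].
have LG : dominated_graph L.
  split=> [a _ _ [t _ <-] [s _ <-]|_ [t _ <-]] /=.
    by exists (a * t + s) => //; rewrite scalerDl scalerA mulrDl mulrA.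
  by rewrite normrZ ler_wpM2r// ler_norm.
have L0 : L !=set0 by exists (0 *: v, 0 * `|v|), 0.
have [B [BG LB Btot]] := maximal_dominated_graph LG L0.
have [f Bf] := choice Btot.
have f_linear : scalar f.
  move=> a x y; apply: (dominated_graph_fun BG (Bf _)).
  exact: (BG.1 a (x, f x) (y, f y)).
pose F := GRing.isLinear.Build R V R *%R f f_linear.
pose g : {scalar V} := HB.pack f F.
exists g; split.
  apply: (dominated_graph_fun BG (Bf _)); apply: LB.
  by exists 1 => //; rewrite scale1r mul1r.
move=> x; rewrite ler_norml; apply/andP; split; last exact: (BG.2 _ (Bf x)).
by rewrite lerNl -normrN -(linearN g); exact: (BG.2 _ (Bf _)).
Qed.

End hahn_banach.

(** * Functionals on c0(G) and their tails *)

Section c0_functionals.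
Context (R : realType) (G : choiceType).
Implicit Types (f h : c0 R G) (g : G).

Lemma c0_ler_norm f g : `|f g| <= `|f|.
Proof. exact: (sup_norm_ub (c0_bounded f)). Qed.

Lemma c0_norm_le f (M : R) : 0 <= M -> (forall g, `|f g| <= M) -> `|f| <= M.
Proof. by move=> M0 fM; apply: sup_norm_le. Qed.

Lemma c0_scaleE (a : R) f g : (a *: f) g = a * f g.
Proof. by []. Qed.

Lemma c0_subE f h g : (f - h) g = f g - h g.
Proof. by []. Qed.

Lemma c0_addE f h g : (f + h) g = f g + h g.
Proof. by []. Qed.

Lemma vanishing_delta g : (fun x => (x == g)%:R) \in @vanishing R G.
Proof.
rewrite inE => /= e e0; apply: (@sub_finite_set _ _ [set g]) => // x /=.
by have [//|_] := eqVneq x g; rewrite normr0 leNgt e0.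
Qed.

Definition c0_delta g : c0 R G := C0 (vanishing_delta g).

Lemma vanishing_restr f (s : seq G) :
  (fun x => if x \in s then f x else 0) \in @vanishing R G.
Proof.
rewrite inE => /= e e0; apply: (@sub_finite_set _ _ [set` s]) => // x /=.
by case: ifP => //; rewrite normr0 leNgt e0.
Qed.

Definition c0_restr f (s : seq G) : c0 R G := C0 (vanishing_restr f s).

Lemma c0_restr_dense f (e : R) : 0 < e ->
  exists s, `|f - c0_restr f s| <= e.
Proof.
move=> e0; have := valP f; rewrite inE => /(_ e e0) /finite_seqP[s sE].
exists s; apply: c0_norm_le => [|x]; first exact: ltW.
rewrite c0_subE /=; case: ifPn => [_|xs]; first by rewrite subrr normr0 ltW.
rewrite subr0 leNgt; apply/negP => /ltW xe; move/negP: xs; apply.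
by have : [set` s] x by rewrite -sE.
Qed.

(** In terms of the dual l1(G), this is the smallness of tails of summable families. Here [s]
    supports an almost maximizer of [phi] on the unit ball. *)
Lemma c0_functional_small_tail (phi : {scalar c0 R G}) (C e : R) :
    (forall f, `|phi f| <= C * `|f|) -> 0 < e ->
  exists s : seq G, forall f, (forall g, g \in s -> f g = 0) ->
    `|phi f| <= e * `|f|.
Proof.
(* [C] need not be positive, and [D] serves as a divisor. *)
move=> phiC e0; pose D := `|C| + 1; have D0 : 0 < D by rewrite ltr_wpDl.
have phiD f : `|phi f| <= D * `|f|.
  by rewrite (le_trans (phiC f))// ler_wpM2r// ler_wpDr// ler_norm.
pose E := [set phi f | f in [set f | `|f| <= 1]].
have E_sup : has_sup E.
  split; first by exists (phi 0), 0; rewrite //= normr0.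
  exists D => _ [f f1 <-]; apply: le_trans (ler_norm _) _.
  by rewrite (le_trans (phiD f))// ler_piMr// ltW.
(* Half of [e] is spent on almost attaining the supremum, half on truncating to a finite support. *)
have e2 : 0 < e / 2 by rewrite divr_gt0.
have [_ [f1 f1_le1 <-] phif1] := sup_adherent e2 E_sup.
have [s fs] : exists s, `|f1 - c0_restr f1 s| <= e / 2 / D.
  by apply: c0_restr_dense; rewrite divr_gt0.
pose f0 := c0_restr f1 s.
have phif0 : sup E - e < phi f0.
  have : phi f1 - phi f0 <= e / 2.
    rewrite -linearB (le_trans (ler_norm _))// (le_trans (phiD _))//.
    by rewrite mulrC -ler_pdivlMr.
  by lra.
(* [f0] almost maximizes [phi] on the unit ball, in which it can be moved
   freely outside its support. *)
have ball f : (forall g, g \in s -> f g = 0) -> `|f| <= 1 -> phi f <= e.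
  move=> f_s f_le1; have : phi (f0 + f) <= sup E.
    apply: ub_le_sup; first by case: E_sup.
    exists (f0 + f) => //=; apply: c0_norm_le => // x.
    rewrite c0_addE /=; case: ifPn => [/f_s ->|_].
      by rewrite addr0 (le_trans (c0_ler_norm _ _)).
    by rewrite add0r (le_trans (c0_ler_norm _ _)).
  by rewrite linearD; lra.
have upper f : (forall g, g \in s -> f g = 0) -> phi f <= e * `|f|.
  move=> f_s; have [->|f_neq0] := eqVneq f 0.
    by rewrite linear0 normr0 mulr0.
  have f_gt0 : 0 < `|f| by rewrite normr_gt0.
  have : phi (`|f|^-1 *: f) <= e.
    apply: ball => [g gs|]; first by rewrite c0_scaleE f_s// mulr0.
    by rewrite normrZ gtr0_norm ?invr_gt0// mulVf ?gt_eqF.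
  by rewrite linearZ /= mulrC ler_pdivrMr.
exists s => f f_s; rewrite ler_norml upper// andbT lerNl -linearN -normrN.
by apply: upper => g /f_s fg0; rewrite -scaleN1r c0_scaleE fg0 mulr0.
Qed.

End c0_functionals.

(** * Rosenthal's theorem for operators on c0(G) *)

Section rosenthal.
Context (R : realType) (G : choiceType) (X : normedModType R).
Implicit Types (S : {linear c0 R G -> X}) (V W : set G) (f h : c0 R G) (g : G).

Lemma scalar_comp_linear S (phi : {scalar X}) : scalar (phi \o S).
Proof. by move=> a f h; rewrite /= linearP linearP. Qed.

Lemma c0_operator_uncountable_lower_bound S V (C : R) :
    (forall f, `|S f| <= C * `|f|) -> ~ countable V ->
    (forall g, V g -> S (c0_delta R g) != 0) ->
  exists W (c : R), [/\ W `<=` V, ~ countable W, 0 < c &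
    forall f, (forall g, ~ W g -> f g = 0) -> c * `|f| <= `|S f|].
Proof.
move=> SC Vu SV.
pose V_ k := [set g | k.+1%:R^-1 <= `|S (c0_delta R g)|].
have [|k _ Vku] := @uncountable_bigcup _ nat setT V V_ (countableP _) Vu.
  move=> g Vg; have Sg : 0 < `|S (c0_delta R g)| by rewrite normr_gt0 SV.
  have [k kg] := ltr_add_invr Sg.
  by exists k => //=; rewrite add0r in kg; exact: ltW.
pose d : R := k.+1%:R^-1; have d0 : 0 < d by rewrite invr_gt0.
have d2 : 0 < d / 2 by rewrite divr_gt0.
have /choice[phi phiP] : forall g, exists phi : {scalar X},
    phi (S (c0_delta R g)) = `|S (c0_delta R g)| /\ forall x, `|phi x| <= `|x|.
  by move=> g; exact: norming_functional.
have /choice[F FP] : forall g, exists s : seq G, forall f,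
    (forall x, x \in s -> f x = 0) -> `|phi g (S f)| <= d / 2 * `|f|.
  move=> g.
  pose L := GRing.isLinear.Build _ _ _ _ _ (scalar_comp_linear S (phi g)).
  pose psi : {scalar c0 R G} := HB.pack (phi g \o S) L.
  apply: (@c0_functional_small_tail _ _ psi C _ _ d2) => f.
  by apply: le_trans (SC f); have [_] := phiP g; exact.
have [W [WV Wu Wfree]] := uncountable_free_set F Vku.
exists W, (d / 2); split=> // [g /WV[]//|f fW].
(* This is proved coordinate by coordinate, with [d * |f g|] on the left; the supremum over [g] then
   gives it. *)
suff : d * `|f| <= `|S f| + d / 2 * `|f| by lra.
have bound0 : 0 <= `|S f| + d / 2 * `|f| by rewrite addr_ge0// mulr_ge0// ltW.
rewrite -ler_pdivlMl//; apply: c0_norm_le => [|g].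
  by rewrite mulr_ge0// invr_ge0 ltW.
rewrite ler_pdivlMl//.
have [Wg|/fW ->] := pselect (W g); last by rewrite normr0 mulr0.
(* Since [f] vanishes off [W] and [W] is free, [h] vanishes on [F g]; so [phi g] is small at [S h]
   and sees mostly the coordinate [g] of [f]. *)
pose h := f - f g *: c0_delta R g.
have hx x : h x = if x == g then 0 else f x.
  rewrite c0_subE c0_scaleE /=; case: eqVneq => [->|_].
    by rewrite mulr1 subrr.
  by rewrite mulr0 subr0.
have h_f : `|h| <= `|f|.
  apply: c0_norm_le => // x; rewrite hx.
  case: ifP => _; first by rewrite normr0.
  exact: c0_ler_norm.
have phih : `|phi g (S h)| <= d / 2 * `|h|.
  apply: FP => x xF; rewrite hx; case: eqVneq => // xg; apply: fW => Wx.
  by have /negP := Wfree _ _ Wx Wg xg.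
have Sf : S f = S h + f g *: S (c0_delta R g).
  by rewrite -linearZ -linearD subrK.
have [phig phi1] := phiP g.
have /= dg : d <= `|S (c0_delta R g)| by have [] := WV _ Wg.
have : d * `|f g| <= `|phi g (S f) - phi g (S h)|.
  rewrite Sf linearD addrAC subrr add0r linearZ /= phig normrM normr_id mulrC.
  by rewrite ler_wpM2l.
have := ler_normB (phi g (S f)) (phi g (S h)); have := phi1 (S f).
have : d / 2 * `|h| <= d / 2 * `|f| by rewrite ler_pM2l.
by lra.
Qed.

End rosenthal.

(** * Embeddings as operators bounded above and below *)

Section embeddings.
Context (R : realType).

Lemma isomorphic_to_subspaceP (E F : normedModType R) :
  isomorphic_to_subspace E F <-> exists (T : {linear E -> F}) (c C : R),
    0 < c /\ forall x, c * `|x| <= `|T x| <= C * `|x|.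
Proof.
split=> [[Z [T [S [_ [ZT TS _ Tcont Scont]]]]]|[T [c [C [c_gt0 Tb]]]]].
  have /linear_bounded_continuous/linear_boundedP TC := Tcont.
  have [C TC_] := filter_ex TC.
  have S0 : S 0 = 0 by rewrite -[in LHS](linear0 T) TS.
  have Z0 : Z 0 by rewrite -(linear0 T).
  have /subspace_continuousP/(_ _ Z0)/cvgrPdist_lt/(_ _ ltr01) := Scont.
  rewrite /within /= => /nbhs_norm0P[d /= d0 dS].
  (* If [|T x| < d / 2 * |x|], the normalized [x] has an image of norm below [d] that [S] sends back
     to a unit vector, against [dS]. *)
  exists T, (d / 2), C; split=> [|x]; first by rewrite divr_gt0.
  rewrite TC_ andbT leNgt; apply/negP => Tx.
  have x_neq0 : x != 0.
    by apply: contraTneq Tx => ->; rewrite linear0 !normr0 mulr0 ltxx.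
  have x_gt0 : 0 < `|x| by rewrite normr_gt0.
  suff : `|S 0 - S (T (`|x|^-1 *: x))| < 1.
    by rewrite TS S0 sub0r normrN normrZ normfV normr_id mulVf ?gt_eqF// ltxx.
  apply: (dS (T (`|x|^-1 *: x))); last exact: ZT.
  rewrite /= linearZ normrZ normfV normr_id ltr_pdivrMl// mulrC.
  by rewrite (lt_trans Tx)// ltr_pM2r//; lra.
have T_inj x y : T x = T y -> x = y.
  move=> Txy; apply/eqP; rewrite -subr_eq0 -normr_le0.
  have /andP[+ _] := Tb (x - y).
  by rewrite linearB Txy subrr normr0 -ler_pdivlMl// mulr0.
(* Off the range of [T] this is the default 0; continuity is only asked within the range, where [S]
   is Lipschitz with constant [c^-1]. *)
pose S z := xget 0 [set x | T x = z].
have TS z : range T z -> T (S z) = z.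
  move=> [x _ Txz].
  exact: (@xgetPex _ 0 [set x | T x = z] (ex_intro _ x Txz)).
exists (range T), T, S; split.
  split=> [|a u v]; rewrite !inE => /=; first by exists 0; rewrite ?linear0.
  move=> [x _ <-] [y _ <-]; exists (a *: x + y) => //.
  by rewrite linearP.
split=> //.
- by move=> x; apply: T_inj; apply: TS; exists x.
- move=> x; apply: bounded_linear_continuous.
  apply/linear_boundedP; exists C; split=> [|r Cr y]; first exact: num_real.
  by have /andP[_ TC] := Tb y; rewrite (le_trans TC)// ler_wpM2r// ltW.
- apply/subspace_continuousP => z Zz; apply/cvgrPdist_lt => e e0.
  rewrite /within /=; apply/nbhs_normP; exists (c * e) => /=.
    by rewrite mulr_gt0.
  move=> w /= zw Zw; rewrite -(ltr_pM2l c_gt0); apply: le_lt_trans zw.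
  by have /andP[+ _] := Tb (S z - S w); rewrite linearB !TS.
Qed.

Lemma card_le_inj (G : Type) (W : set G) : ([set: G] #<= W)%card ->
  exists2 j : G -> G, injective j & forall g, W (j g).
Proof.
move=> /card_leP[f]; exists (fun g => set_val (f (to_setT g))).
  move=> x y /val_inj fxy.
  by have /(congr1 set_val) := in2TT (@inj _ _ _ f) _ _ fxy.
by move=> g; apply: set_valP.
Qed.

(** * Isometric copies of c0(G) supported on the range of an injection *)

Section c0_extension.
Context (G : choiceType) (j : G -> G) (j_inj : injective j).

Definition extend_by0 (f : G -> R) (g : G) : R :=
  if pselect (exists x, j x = g) is left h then f (projT1 (cid h)) else 0.

Lemma extend_by0_id f x : extend_by0 f (j x) = f x.
Proof.
rewrite /extend_by0; case: pselect => [h|[]]; last by exists x.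
by case: cid => y /= /j_inj ->.
Qed.

Lemma extend_by0_out f g : ~ range j g -> extend_by0 f g = 0.
Proof.
by rewrite /extend_by0; case: pselect => // -[x xg] []; exists x.
Qed.

Lemma vanishing_extend_by0 (f : c0 R G) : extend_by0 f \in @vanishing R G.
Proof.
have := valP f; rewrite !inE => /= fv e e0.
apply: sub_finite_set (finite_image j (fv e e0)) => g /=.
have [[x _ <-]|gj] := pselect (range j g).
  by rewrite extend_by0_id; exists x.
by rewrite extend_by0_out// normr0 leNgt e0.
Qed.

Definition c0_extend (f : c0 R G) : c0 R G := C0 (vanishing_extend_by0 f).

Lemma c0_extend_linear : linear c0_extend.
Proof.
move=> a f h; apply/val_inj/funext => g.
change (extend_by0 (a *: f + h) g = a * extend_by0 f g + extend_by0 h g).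
have [[x _ <-]|gj] := pselect (range j g); first by rewrite !extend_by0_id.
by rewrite !extend_by0_out// mulr0 addr0.
Qed.

HB.instance Definition _ :=
  GRing.isLinear.Build R (c0 R G) (c0 R G) *:%R c0_extend c0_extend_linear.

Lemma c0_norm_extend (f : c0 R G) : `|c0_extend f| = `|f|.
Proof.
apply/eqP; rewrite eq_le; apply/andP; split; apply: c0_norm_le => // g /=.
  have [[x _ <-]|gj] := pselect (range j g).
    by rewrite extend_by0_id c0_ler_norm.
  by rewrite extend_by0_out// normr0.
by rewrite -(extend_by0_id f) (c0_ler_norm (c0_extend f)).
Qed.

End c0_extension.
End embeddings.

(** * Evaluation on dense sets and rank one operators *)

Section bounded_operator_facts.
Context (R : realType) (X Y : normedModType R).

Lemma bop_continuous (f : bop Y X) : continuous f.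
Proof.
apply: bounded_linear_continuous; apply/linear_boundedP.
exists (op_norm f); split=> [|r fr y]; first exact: num_real.
by rewrite (le_trans (op_normP f y))// ler_wpM2r// ltW.
Qed.

(** By continuity, the set where [f] does not vanish is open, and it is nonempty. *)
Lemma bop_neq0_dense (D : set Y) (f : bop Y X) : dense D -> f != 0 ->
  exists2 y, D y & f y != 0.
Proof.
move=> D_dense f_neq0.
have fO : open (f @^-1` ~` [set 0]).
  apply: open_comp => [y _|]; first exact: bop_continuous.
  apply: closed_openC; apply: accessible_closed_set1.
  exact: hausdorff_accessible (@norm_hausdorff _ _).
have [|y [/eqP fy Dy]] := D_dense _ _ fO; last by exists y.
apply/set0P; apply: contra f_neq0 => /eqP fO0; apply/eqP/val_inj/funext => y /=.
apply: contrapT => fy.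
by have : set0 y by rewrite -fO0.
Qed.

Lemma bop_rank1_subproof (phi : {scalar Y}) (x : X) :
  (forall y, `|phi y| <= `|y|) ->
  (fun y => phi y *: x) \in @bounded_operator R Y X.
Proof.
move=> phi1; rewrite inE /=; split=> [a y z|].
  by rewrite linearP scalerDl scalerA.
by exists `|x| => y; rewrite normrZ mulrC ler_wpM2l.
Qed.

Lemma bop_isometric_embedding : (exists y : Y, y != 0) ->
  exists T : {linear X -> bop Y X}, forall x, `|T x| = `|x|.
Proof.
move=> [y y_neq0]; have [phi [phiy phi1]] := norming_functional y.
pose t x : bop Y X := Bop (bop_rank1_subproof x phi1).
have t_linear : linear t.
  move=> a u v; apply/val_inj/funext => z.
  change (phi z *: (a *: u + v) = a *: (phi z *: u) + phi z *: v).
  by rewrite scalerDr !scalerA mulrC.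
pose L := GRing.isLinear.Build _ _ _ _ t t_linear.
pose T : {linear X -> bop Y X} := HB.pack t L.
exists T => x; apply/eqP; rewrite eq_le; apply/andP; split.
  apply: sup_norm_le => // z z1 /=.
  by rewrite normrZ ler_piMl// (le_trans (phi1 z)).
(* Testing at [y], where [phi] attains the bound, gives the other inequality. *)
have := op_normP (t x) y; rewrite /= normrZ phiy normr_id mulrC.
by rewrite ler_pM2r// normr_gt0.
Qed.

Lemma bop_eval_linear (E : normedModType R) (T : {linear E -> bop Y X})
    (y : Y) :
  linear (fun x => T x y).
Proof. by move=> a u v; rewrite linearP. Qed.

End bounded_operator_facts.

(** * Passage between operators and their values *)

Lemma c0_embedding_of_bop (R : realType) (X Y : normedModType R)
    (G : choiceType) : separable Y -> has_card_aleph1 G ->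
  isomorphic_to_subspace (c0 R G) (bop Y X) ->
  isomorphic_to_subspace (c0 R G) X.
Proof.
move=> [D Dc D_dense] [Gu Gmin] /isomorphic_to_subspaceP[T [c [C [c_gt0 Tb]]]].
have [|y Dy Vu] := @uncountable_bigcup _ Y D setT
    (fun y => [set g | T (c0_delta R g) y != 0]) Dc Gu.
  move=> g _; suff /(bop_neq0_dense D_dense)[y Dy Ty] : T (c0_delta R g) != 0.
    by exists y.
  have /andP[+ _] := Tb (c0_delta R g); apply: contraTneq => ->.
  rewrite normr0 -ltNge mulr_gt0// normr_gt0; apply/eqP => e0.
  have : c0_delta R g g = 0 by rewrite e0.
  by rewrite /= eqxx => /eqP; rewrite oner_eq0.
pose L := GRing.isLinear.Build _ _ _ _ _ (bop_eval_linear T y).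
pose S : {linear c0 R G -> X} := HB.pack (fun f => T f y) L.
have SC f : `|S f| <= C * `|y| * `|f|.
  have /andP[_ TC] := Tb f; rewrite (le_trans (op_normP (T f) y))//.
  by rewrite mulrAC ler_wpM2r.
have [|W [b [_ Wu b0 SW]]] :=
    c0_operator_uncountable_lower_bound (S := S) SC Vu.
  by move=> g [].
have [j j_inj jW] := card_le_inj (Gmin _ _ Wu).
(* Extension by zero along [j] is isometric, with values supported in [W], where [S] is bounded
   below by [b]. *)
apply/isomorphic_to_subspaceP; exists (S \o c0_extend j_inj), b, (C * `|y|).
split=> // f; rewrite -(c0_norm_extend j_inj f) SC andbT; apply: SW => g Wg.
by apply: extend_by0_out => -[x _ xg]; apply: Wg; rewrite -xg.
Qed.

(** For the zero space [Y] the converse can fail: [bop Y X] is then zero, whereas [c0 R G] is not.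
    Hence [Y_neq0]. *)
Theorem proposition4p1 (R : realType) (X Y : completeNormedModType R)
    (Y_neq0 : exists y : Y, y != 0) (Y_separable : separable Y)
    (G : Type) (G_aleph1 : has_card_aleph1 G) :
  isomorphic_to_subspace (c0 R G) (bop Y X) <->
  isomorphic_to_subspace (c0 R G) X.
Proof.
(* [{classic G}] gives the bare type [G] the decidable equality and choice used for unit vectors and
   free sets. *)
split; first exact: (@c0_embedding_of_bop R X Y {classic G}).
have [T Tisom] := bop_isometric_embedding X Y_neq0.
move=> /isomorphic_to_subspaceP[S [c [C [c_gt0 Sb]]]].
apply/isomorphic_to_subspaceP; exists (T \o S), c, C; split=> // x.
by rewrite /= Tisom.
Qed.
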